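(* Let $m,a$ be positive integers and let $a_1,\dots,a_r$ be positive integers with $\sum_i a_i=12$. Consider nonsingular hypersurfaces $D_1,\dots,D_r$ (not necessarily distinct) of class $a_iL$ in the double cover $\rho:X\to B$ and a nonsingular hypersurface $Z$ of class $aL$ in $B$, in the Calabi-Yau case $L=c_1(B)$ with $\dim B=3$. Then the relation $$2m\,\chi(Z)=\sum_{i=1}^r\chi(D_i)$$ is universally satisfied (subject to $L=c_1(B)$ and $\dim B=3$) precisely in the following six cases, up to reordering the $a_i$: - $(m,a)=(3,4)$, $(a_i)=(1,1,1,1,4,4)$; - $(m,a)=(4,3)$, $(a_i)=(1,1,1,1,1,1,3,3)$; - $(m,a)=(6,2)$, $(a_i)=(1,\dots,1)$ (twelve $1$'s); - $(m,a)=(2,6)$, $(a_i)=(1,1,1,1,1,7)$; - $(m,a)=(3,4)$, $(a_i)=(1,1,1,1,1,1,1,5)$; - $(m,a)=(4,3)$, $(a_i)=(1,2,2,2,2,3)$.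
   Context: $B$ is a nonsingular compact complex variety with a line bundle $\mathscr L$, $L=c_1(\mathscr L)$, $h$ is a section of $\mathscr L^2$ with nonsingular zero-locus, and $\rho:X\to B$ is the double cover of $B$ with equation $\xi^2=h$ in the total space of $\mathscr L$; we also write $L$ for $\rho^*L$. For nonsingular $V$, $c(V)=c(TV)\cap[V]$ and $\chi(V)=\int c(V)$. By adjunction, $c(Z)=\frac{aL}{1+aL}\,c(B)$, $c(D_i)=\frac{a_iL}{1+a_iL}\,c(X)$, $c(X)=\frac{1+L}{1+2L}\,\rho^*(c(TB))\cap[X]$, and $\rho_*[X]=2[B]$; hence $\chi(Z)$ and $\chi(D_i)$ are degrees of the degree-$3$ parts of universal expressions in $L$ and $c(B)=1+c_1(B)+c_2(B)+c_3(B)$ ($L$ and $c_i(B)$ having degree $1$ and $i$). The relation is ''universally satisfied subject to $L=c_1(B)$ and $\dim B=3$'' if, after substituting $L=c_1(B)$, the degree-$3$ parts of the two sides agree as polynomials in the indeterminates $c_1(B),c_2(B)$. *)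

(* Defs.v *)
From HB Require Import structures.
From mathcomp Require Import all_boot all_order all_algebra.
From mathcomp.multinomials Require Import mpoly.

Set Implicit Arguments.
Unset Strict Implicit.
Unset Printing Implicit Defensive.

Import GRing.Theory.
Local Open Scope ring_scope.

(* Universal classes on a threefold base B. The coefficient ring is
   Z[L, c1, c2, c3], with L = c_1(L) and c_i = c_i(B). A total (inhomogeneous)
   class is written as a polynomial in one more variable 'X which records the
   codimension: the coefficient of 'X^i is the degree-i part of the class. *)
Definition uring : comNzRingType := {mpoly int[4]}.

Definition clL : uring := 'X_(Ordinal (isT : 0 < 4)%N).
Definition clc1 : uring := 'X_(Ordinal (isT : 1 < 4)%N).
Definition clc2 : uring := 'X_(Ordinal (isT : 2 < 4)%N).
Definition clc3 : uring := 'X_(Ordinal (isT : 3 < 4)%N).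

(* Inverse of a total class with degree-0 part 1, i.e. its geometric series cut
   off in degrees > 3; see [cinvP]. *)
Definition cinv (R : nzRingType) (u : {poly R}) : {poly R} :=
  take_poly 4 (\sum_(k < 4) (1 - u) ^+ k).

Lemma cinvP (R : comNzRingType) (u : {poly R}) :
  u`_0 = 1 -> take_poly 4 (u * cinv u) = 1.
Proof.
move=> u0; set v := 1 - u.
have [w vE] : exists w, v = w * 'X.
  have /factor_theorem[w ->] : root v 0.
    by rewrite /root /v hornerD hornerN hornerC horner_coef0 u0 subrr.
  by exists w; rewrite polyC0 subr0.
pose g := \sum_(k < 4) v ^+ k.
have ug : u * g = 1 - w ^+ 4 * 'X^4.
  have -> : u = 1 - v by rewrite /v opprB addrC subrK.
  by rewrite -exprMn -vE -[RHS]opprB subrX1 -mulNr -[1 - v]opprB.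
have cE : cinv u = g - drop_poly 4 g * 'X^4.
  by rewrite /cinv -/v -/g -[X in X - _](poly_take_drop 4) addrK.
rewrite cE mulrBr ug [u * (_ * _)]mulrA -addrA -opprD -mulrDl.
rewrite take_polyD -mulNr take_polyMXn_0 addr0.
by rewrite take_poly_id // size_poly1.
Qed.

(* c(TB) *)
Definition chernB : {poly uring} :=
  1 + clc1 *: 'X + clc2 *: 'X^2 + clc3 *: 'X^3.

(* 1 + bL, the total Chern class of the b-th tensor power of the line bundle *)
Definition chernO (b : nat) : {poly uring} := 1 + (clL *+ b) *: 'X.

(* All classes needed on the double cover X are pullbacks from B; the class
   pulled back from alpha is represented by alpha itself. With this convention,
   c(X) = (1 + L) / (1 + 2L) * c(TB). *)
Definition chernX : {poly uring} := chernO 1 * cinv (chernO 2) * chernB.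

(* c(H) = bL / (1 + bL) * c(V), for a nonsingular hypersurface H of class bL in
   V, where cV is the total Chern class of V *)
Definition chernHyp (b : nat) (cV : {poly uring}) : {poly uring} :=
  (clL *+ b) *: 'X * cinv (chernO b) * cV.

(* The integrands on B computing degrees on B and on X: the degree-3 part and,
   since pushing forward [X] gives 2[B], twice the degree-3 part. *)
Definition degB (al : {poly uring}) : uring := al`_3.
Definition degX (al : {poly uring}) : uring := al`_3 *+ 2.

Definition chiZ (a : nat) : uring := degB (chernHyp a chernB).
Definition chiD (b : nat) : uring := degX (chernHyp b chernX).

(* The substitution L = c1(B), with values in Z[c1, c2, c3]. On degree-3 parts
   of multiples of L the result only involves c1 and c2. *)
Definition substCY (p : uring) : {mpoly int[3]} :=
  comp_mpoly
    [tuple 'X_(Ordinal (isT : 0 < 3)%N); 'X_(Ordinal (isT : 0 < 3)%N);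
           'X_(Ordinal (isT : 1 < 3)%N); 'X_(Ordinal (isT : 2 < 3)%N)] p.

Definition universally_satisfied_CY (lhs rhs : uring) : Prop :=
  substCY lhs = substCY rhs.

(* Main.v *)
Require Import Defs.
From HB Require Import structures.
From mathcomp Require Import all_boot all_order all_algebra.
From mathcomp.multinomials Require Import mpoly.
From mathcomp Require Import ring zify.

Set Implicit Arguments.
Unset Strict Implicit.
Unset Printing Implicit Defensive.

Import GRing.Theory.
Local Open Scope ring_scope.

(* With L = c1 the degree-3 parts are
   chi(Z) = a c1 c2 + (a^3 - a^2) c1^3 and chi(D_i) = 2 (a_i c1 c2 + (a_i^3 + a_i) c1^3),
   so the relation amounts to m a = sum a_i and m (a^3 - a^2) = sum (a_i^3 + a_i).
   Since sum a_i = 12, it remains to search through the divisors a of 12 and the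
   partitions of 12. *)

(** The [k]-th term of the geometric series is $(-x)^k X^k$, so degree [i] receives only the term
    [k = i]. *)
Lemma coef_cinv_linear (R : comNzRingType) (x : R) (i : nat) :
  (i < 4)%N -> (cinv (1 + x *: 'X))`_i = (- x) ^+ i.
Proof.
move=> lti4; rewrite /cinv coef_take_poly lti4 coef_sum.
rewrite (bigD1 (Ordinal lti4)) //= big1 => [|j neq_ji];
  rewrite opprD addNKr -scaleNr exprZn coefZ coefXn ?eqxx ?mulr1 ?addr0 //.
by rewrite eq_sym -[i]/(val (Ordinal lti4)) val_eqE (negPf neq_ji) mulr0.
Qed.

(** The factor $xX$ shifts degrees by one, so only degrees at most 2 of the ambient class enter;
    hence $c_3(B)$ never appears. *)
Lemma coef3_hypersurface (R : comNzRingType) (x : R) (u : {poly R}) :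
  (x *: 'X * cinv (1 + x *: 'X) * u)`_3
    = x * u`_2 - x ^+ 2 * u`_1 + x ^+ 3 * u`_0.
Proof.
rewrite -!scalerAl -mulrA coefZ coefXM /= coefM !big_ord_recl big_ord0 /bump /=.
by rewrite !coef_cinv_linear //; ring.
Qed.

(** Multiply [u] by the expansion $(1+x)/(1+2x) = 1 - x + 2x^2 - \dots$ *)
Lemma coef_double_cover (R : comNzRingType) (x : R) (u : {poly R}) :
  let v := (1 + x *: 'X) * cinv (1 + (x *+ 2) *: 'X) * u in
  [/\ v`_0 = u`_0, v`_1 = u`_1 - x * u`_0
    & v`_2 = u`_2 - x * u`_1 + 2 * x ^+ 2 * u`_0].
Proof.
by split; rewrite -mulrA mulrDl mul1r -scalerAl coefD coefZ coefXM /=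
  !coefM !big_ord_recl !big_ord0 /bump /= !coef_cinv_linear //; ring.
Qed.

Lemma coef_chernB :
  [/\ chernB`_0 = 1, chernB`_1 = clc1 & chernB`_2 = clc2].
Proof.
by split; rewrite /chernB !coefD !coefZ coefX !coefXn coef1 /=
  !(mulr0, mulr1, addr0, add0r).
Qed.

Lemma chiZE a :
  chiZ a = clL *+ a * clc2 - (clL *+ a) ^+ 2 * clc1 + (clL *+ a) ^+ 3.
Proof.
by have [c0 c1 c2] := coef_chernB;
  rewrite /chiZ /degB coef3_hypersurface c0 c1 c2 mulr1.
Qed.

Lemma chiDE b :
  chiD b = (clL *+ b * (clc2 - clL * clc1 + 2 * clL ^+ 2)
            - (clL *+ b) ^+ 2 * (clc1 - clL) + (clL *+ b) ^+ 3) *+ 2.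
Proof.
have [c0 c1 c2] := coef_chernB.
have [e0 e1 e2] := coef_double_cover clL chernB.
by rewrite /chiD /degX coef3_hypersurface e0 e1 e2 c0 c1 c2 !mulr1.
Qed.

Definition c1CY : {mpoly int[3]} := 'X_(Ordinal (isT : 0 < 3)%N).
Definition c2CY : {mpoly int[3]} := 'X_(Ordinal (isT : 1 < 3)%N).

Lemma substCY_chiZ a :
  substCY (chiZ a) = c1CY * c2CY *+ a + c1CY ^+ 3 * (a%:R ^+ 3 - a%:R ^+ 2).
Proof.
rewrite chiZE /substCY !(rmorphD, rmorphN, rmorphM, rmorphXn, rmorphMn) /=.
rewrite !comp_mpolyXU /= -/c1CY -/c2CY.
by move: c1CY c2CY => x y; ring.
Qed.

(** At $L = c_1$ the factor $c_1 - L = c_1(X)$ of the quadratic term vanishes, while the linear term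
    becomes $b(c_2 + c_1^2)$ times $c_1$. *)
Lemma substCY_chiD b :
  substCY (chiD b) = (c1CY * c2CY *+ b + c1CY ^+ 3 * (b%:R ^+ 3 + b%:R)) *+ 2.
Proof.
rewrite chiDE /substCY !(rmorphD, rmorphN, rmorphM, rmorphXn, rmorphMn) /=.
rewrite !comp_mpolyXU /= -/c1CY -/c2CY.
by move: c1CY c2CY => x y; ring.
Qed.

Lemma c1c2_c1cube_free (u v u' v' : int) :
  c1CY * c2CY * u%:~R + c1CY ^+ 3 * v%:~R
    = c1CY * c2CY * u'%:~R + c1CY ^+ 3 * v'%:~R <-> u = u' /\ v = v'.
Proof.
split=> [e|[-> ->] //].
(* Setting $c_1 = 1$ and $c_2 = y$ gives $yu + v$; the values at $y = 0, 1$ determine $u$ and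
   $v$. *)
pose ev (y : int) := meval (fun i : 'I_3 => if i == ord0 then 1 else y).
have evE y p q : ev y (c1CY * c2CY * p%:~R + c1CY ^+ 3 * q%:~R) = y * p + q.
  rewrite /ev !(rmorphD, rmorphM, rmorphXn, rmorph_int) /= !mevalXU /=.
  by rewrite !intz; ring.
by have := congr1 (ev 0) e; have := congr1 (ev 1) e; rewrite !evE; lia.
Qed.

(** Coefficients of $c_1c_2$ and $c_1^3$ are compared, and the 2 from $\rho_*[X] = 2[B]$ cancels
    that of $2m$. Moving $ma^2$ to the right avoids subtraction in [nat]. *)
Lemma relation_iff (m a : nat) (s : seq nat) :
  universally_satisfied_CY (chiZ a *+ (2 * m)) (\sum_(b <- s) chiD b)
  <-> (m * a = \sum_(b <- s) b
       /\ m * a ^ 3 = m * a ^ 2 + \sum_(b <- s) (b ^ 3 + b))%N.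
Proof.
rewrite /universally_satisfied_CY.
have -> : substCY (chiZ a *+ (2 * m)) =
   c1CY * c2CY * (2 * m%:Z * a%:Z)%:~R
   + c1CY ^+ 3 * (2 * m%:Z * (a%:Z ^+ 3 - a%:Z ^+ 2))%:~R.
  rewrite {1}/substCY rmorphMn /= -/(substCY _) substCY_chiZ.
  rewrite !(rmorphB, rmorphM, rmorphXn) /= -!pmulrn.
  by move: c1CY c2CY => x y; ring.
have -> : substCY (\sum_(b <- s) chiD b) =
   c1CY * c2CY * (2 * (\sum_(b <- s) b)%N%:Z)%:~R
   + c1CY ^+ 3 * (2 * (\sum_(b <- s) (b ^ 3 + b))%N%:Z)%:~R.
  rewrite {1}/substCY rmorph_sum /= (eq_bigr _ (fun b _ => substCY_chiD b)).
  elim: s => [|b s IHs]; first by rewrite !big_nil !mulr0 addr0.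
  rewrite !big_cons {}IHs !PoszD -!rmorphXn /= !(rmorphD, rmorphM, rmorphXn) /=.
  by rewrite -!pmulrn; move: c1CY c2CY => x y; ring.
rewrite c1c2_c1cube_free.
move: (\sum_(b <- s) b)%N (\sum_(b <- s) (b ^ 3 + b))%N => S T.
by split=> -[]; nia.
Qed.

(* Partitions of [n] into parts at most [k], split by the multiplicity of [k]. *)
Fixpoint bounded_partitions (k n : nat) : seq (seq nat) :=
  if k is k'.+1 then
    flatten [seq [seq nseq j k ++ t | t <- bounded_partitions k' (n - j * k)]
            | j <- iota 0 (n %/ k).+1]
  else if n == 0%N then [:: [::]] else [::].

(** This completeness makes the finite search exhaustive. Removing all copies of the largest allowed
    part leaves a list with a smaller bound. *)
Lemma bounded_partitionsP (k : nat) (s : seq nat) :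
  {in s, forall b, 0 < b <= k}%N ->
  exists2 t, t \in bounded_partitions k (\sum_(b <- s) b) & perm_eq s t.
Proof.
elim: k s => [|k IHk] s bnd_s.
  by case: s bnd_s => [|b s] bnd_s;
    [exists [::]; rewrite ?big_nil | have := bnd_s b (mem_head _ _); lia].
pose s' := [seq b <- s | b != k.+1]; set j := count_mem k.+1 s.
have perm_s : perm_eq s (nseq j k.+1 ++ s').
  rewrite -(perm_filterC (pred1 k.+1)) /j -size_filter.
  by rewrite -(all_pred1P _ _ (filter_all _ _)).
have [|t t_in perm_t] := IHk s'.
  by move=> b; rewrite mem_filter => /andP[nb /bnd_s]; lia.
exists (nseq j k.+1 ++ t); last by rewrite (permPl perm_s) perm_cat2l.
have sumE : (\sum_(b <- s) b = j * k.+1 + \sum_(b <- s') b)%N.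
  by rewrite (perm_big _ perm_s) big_cat big_nseq iter_addn_0 mulnC.
apply/flatten_mapP; exists j.
  by rewrite mem_iota /= add0n ltnS leq_divRL // sumE leq_addr.
by rewrite map_f // sumE addKn.
Qed.

Theorem mainTheorem3 (m a : nat) (s : seq nat)
  (m_gt0 : (0 < m)%N) (a_gt0 : (0 < a)%N)
  (s_gt0 : forall b : nat, b \in s -> (0 < b)%N)
  (s_sum : (\sum_(b <- s) b)%N = 12%N) :
  universally_satisfied_CY (chiZ a *+ (2 * m)) (\sum_(b <- s) chiD b)
  <->
     (m = 3%N /\ a = 4%N /\ perm_eq s [:: 1; 1; 1; 1; 4; 4]%N)
  \/ (m = 4%N /\ a = 3%N /\ perm_eq s [:: 1; 1; 1; 1; 1; 1; 3; 3]%N)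
  \/ (m = 6%N /\ a = 2%N /\ perm_eq s [:: 1; 1; 1; 1; 1; 1; 1; 1; 1; 1; 1; 1]%N)
  \/ (m = 2%N /\ a = 6%N /\ perm_eq s [:: 1; 1; 1; 1; 1; 7]%N)
  \/ (m = 3%N /\ a = 4%N /\ perm_eq s [:: 1; 1; 1; 1; 1; 1; 1; 5]%N)
  \/ (m = 4%N /\ a = 3%N /\ perm_eq s [:: 1; 2; 2; 2; 2; 3]%N).
Proof.
rewrite relation_iff s_sum; split; last first.
  have cubes t : perm_eq s t ->
      (\sum_(b <- s) (b ^ 3 + b) = sumn [seq b ^ 3 + b | b <- t])%N.
    by move=> st; rewrite (perm_big _ st) sumnE big_map.
  by case=> [|[|[|[|[|]]]]] [-> [-> /cubes->]].
case=> ma; have [|t t_in st] := @bounded_partitionsP 12 s.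
  move=> b bs; rewrite s_gt0 //= -s_sum (perm_big _ (perm_to_rem bs)) big_cons.
  exact: leq_addr.
rewrite s_sum in t_in; rewrite (perm_big _ st) -(big_map _ predT id) -sumnE /=.
(* As $ma = 12$, [a] divides 12 and determines [m], so [sols] records only [a] and the parts. *)
have a_in : a \in divisors 12 by rewrite -dvdn_divisors // -ma dvdn_mull.
have -> : m = (12 %/ a)%N by rewrite -ma mulnK.
pose sols : seq (nat * seq nat) :=
  [:: (4, [:: 1; 1; 1; 1; 4; 4]); (3, [:: 1; 1; 1; 1; 1; 1; 3; 3]);
      (2, nseq 12 1); (6, [:: 1; 1; 1; 1; 1; 7]);
      (4, [:: 1; 1; 1; 1; 1; 1; 1; 5]); (3, [:: 1; 2; 2; 2; 2; 3])]%N.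
(* The enumeration puts larger parts first; [rev] matches the increasing order in [sols]. *)
have /allP/(_ _ a_in)/allP/(_ _ t_in)/implyP search :
    all (fun a => all (fun t =>
      (12 %/ a * a ^ 3 == 12 %/ a * a ^ 2 + sumn [seq b ^ 3 + b | b <- t])%N
      ==> ((a, rev t) \in sols)) (bounded_partitions 12 12)) (divisors 12).
  by vm_compute.
move/eqP/search; rewrite !inE !xpair_eqE.
have st' : perm_eq s (rev t) by rewrite perm_sym perm_rev perm_sym.
by do 5?[case/orP]; case/andP=> /eqP-> /eqP tE; rewrite tE in st'; tauto.
Qed.
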